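(* Let $\mu$ be a finite Borel measure in $\mathbb C$ with compact support and let $I\subset[0,\pi]$ be an arbitrary open set. Then $$\iint_{x-y\in K_I\setminus\{0\}}\frac1{|x-y|}\,d\mu(x)\,d\mu(y)\ \le\ \int_{I^\perp}\|P_\theta\mu\|_2^2\,d\theta,$$ where $K_I=\{re^{i\theta}:r\in\mathbb R,\ \theta\in I\}$ and $I^\perp=I+\frac\pi2\pmod\pi$.
   Context: Identify $\mathbb C$ with $\mathbb R^2$; measures are non-negative. $P_\theta$ is the orthogonal projection onto the line $L_\theta=\{re^{i\theta}:r\in\mathbb R\}$, $P_\theta\mu$ is the image measure of $\mu$ under $P_\theta$, and $\|P_\theta\mu\|_2$ is the $L^2$ norm, with respect to length on $L_\theta$, of the density of $P_\theta\mu$ with respect to length ($+\infty$ if there is no density). *)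

(* Defs.v *)
From HB Require Import structures.
From mathcomp Require Import all_boot all_order all_algebra.
From mathcomp Require Import all_classical all_reals all_analysis measurable_realfun.

Set Implicit Arguments.
Unset Strict Implicit.
Unset Printing Implicit Defensive.

Import Order.TTheory GRing.Theory Num.Theory.
Import numFieldNormedType.Exports.

Local Open Scope classical_set_scope.
Local Open Scope ring_scope.

(* The complex plane is [R * R].  Its product topology is the Euclidean
   topology and, [R] being second countable, its product sigma-algebra is the
   Borel sigma-algebra. *)

Section plane.
Context {R : realType}.
Implicit Types (z : R * R) (r t : R) (I : set R).

(* The norm [`|z|] of the library on [R * R] is the max norm, not this one. *)
Definition cmod z : R := Num.sqrt (z.1 ^+ 2 + z.2 ^+ 2).

Definition polar t r : R * R := (r * cos t, r * sin t).

Lemma measurable_polar t : measurable_fun setT (polar t).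
Proof. by apply/measurable_fun_pair => /=; exact: mulrr_measurable. Qed.

Definition line_proj t z : R * R := polar t (z.1 * cos t + z.2 * sin t).

(* Length on the line [range (polar t)]: [polar t] is an isometry from [R]. *)
Definition line_length t : set (R * R) -> \bar R :=
  pushforward (@lebesgue_measure R) (polar t).

Let line_length0 t : line_length t set0 = 0%E.
Proof. by rewrite /line_length /pushforward preimage_set0 measure0. Qed.

Let line_length_ge0 t A : (0 <= line_length t A)%E.
Proof. by have mpolar := @measurable_polar t; exact: measure_ge0. Qed.

Let line_length_sigma_additive t : semi_sigma_additive (line_length t).
Proof.
by have mpolar := @measurable_polar t; exact: measure_semi_sigma_additive.
Qed.

HB.instance Definition _ t := isMeasure.Build _ _ _ (line_length t)
  (line_length0 t) (line_length_ge0 t) (@line_length_sigma_additive t).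

Definition msupport (mu : set (R * R) -> \bar R) : set (R * R) :=
  [set z | forall U, open U -> U z -> (0 < mu U)%E].

Definition cone I : set (R * R) :=
  [set z | exists r t, I t /\ z = polar t r].

(* [I + pi / 2] modulo [pi], with representatives in [0, pi[. *)
Definition perp I : set R :=
  [set t | 0 <= t < pi /\
    exists s (k : int), I s /\ t = s + pi / 2 + k%:~R * pi].

End plane.

Section measures.
Context d (T : measurableType d) (R : realType).
Local Open Scope ereal_scope.
Implicit Types (nu : set T -> \bar R) (sigma : {measure set T -> \bar R}).

Definition is_density nu sigma (f : T -> \bar R) : Prop :=
  [/\ measurable_fun setT f, forall x, 0 <= f x &
      forall A, measurable A -> nu A = \int[sigma]_(x in A) f x].

(* For a sigma-finite [sigma] two densities agree almost everywhere, so the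
   norm does not depend on the chosen one. *)
Definition density_L2norm nu sigma : \bar R :=
  if pselect (exists f, is_density nu sigma f) is left h
  then 'N[sigma]_2%:E[sval (cid h)] else +oo.

End measures.

(* Main.v *)
Require Import Defs.
From HB Require Import structures.
From mathcomp Require Import all_boot all_order all_algebra.
From mathcomp Require Import all_classical all_reals all_analysis.
From mathcomp Require Import measurable_realfun ring lra.

(** Write q_t for the linear form z |-> z.1 cos t + z.2 sin t, so that the
    projection onto the line of direction t is polar t o q_t, and let strip
    delta z be the set of the angles t with |q_t z| <= delta.  Both sides of the
    inequality are compared with the measure of the triples (x, y, t) such
    that t lies in the perpendicular of I and |q_t (x - y)| <= delta,
    normalised by 2 delta.

    For a fixed t, the pairs (x, y) with |q_t x - q_t y| <= delta have mu \x mu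
    measure at most 2 delta times the square of the L2 norm of the projected
    measure.  If that measure has density g on the line, this is Schur's test
    for the kernel 1_(|u - v| <= delta), whose marginals are at most 2 delta:
    use 2 g(u) g(v) <= g(u)^2 + g(v)^2 ([schur_density], [proj_close_pairs]).
    If it has no density the norm is infinite.

    For fixed x and y with x - y = polar s r, s in I and r <> 0, the angles
    t = s' + pi / 2 (modulo pi) satisfy |q_t (x - y)| = |r| |sin (s' - s)|,
    which is at most |r| |s' - s|.  As I is open it contains the interval of
    centre s and radius delta / |r| when delta is small, so these angles have
    length at least 2 delta / |r| ([strip_perp_part]).  Dividing by 2 delta
    gives at least 1 / |x - y|.

    Tonelli's theorem exchanges the two points of view and Fatou's lemma lets
    delta tend to 0.  The two sides are not integrals of functions shown to be
    measurable, but the integral of a non-negative function is a supremum over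
    the simple functions below it and therefore monotone without measurability
    ([ge0_integral_mono]). *)

Set Implicit Arguments.
Unset Strict Implicit.
Unset Printing Implicit Defensive.

Import Order.TTheory GRing.Theory Num.Theory.
Import numFieldNormedType.Exports.

Local Open Scope classical_set_scope.
Local Open Scope ring_scope.
Local Open Scope ereal_scope.

(** * Integrals of non-negative functions *)

Section integral.
Context d (T : measurableType d) (R : realType).
Variable mu : {measure set T -> \bar R}.

(** Every simple function below [f] is below [g], so that one supremum runs over
    a larger set than the other.  This compares integrands that are not known
    to be measurable, such as the norms of the projections. *)
Lemma ge0_integral_mono (f g : T -> \bar R) :
  (forall x, 0 <= f x) -> (forall x, f x <= g x) ->
  \int[mu]_x f x <= \int[mu]_x g x.
Proof.
move=> f0 fg.
have g0 x : 0 <= g x by exact: le_trans (fg x).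
rewrite !ge0_integralTE//; apply: ereal_sup_le => _ [h /= hf <-].
by exists h => //= x; exact: le_trans (fg x).
Qed.

End integral.

Lemma limn_einf_ge_near (R : realType) (u : (\bar R)^nat) (l : \bar R) :
  (\forall n \near \oo, l <= u n) -> l <= limn_einf u.
Proof.
move=> [N _ lu]; rewrite limn_einf_lim; apply: lime_ge;
  first exact: is_cvg_einfs.
exists N => // n /= Nn; apply: le_ereal_inf_tmp => _ [m /= nm <-].
by apply: lu => /=; exact: leq_trans nm.
Qed.

Lemma limn_einf_le (R : realType) (u : (\bar R)^nat) (l : \bar R) :
  (forall n, u n <= l) -> limn_einf u <= l.
Proof.
move=> ul; rewrite limn_einf_lim; apply: lime_le; first exact: is_cvg_einfs.
by apply: nearW => n; apply: le_trans (ul n); apply: ereal_inf_lbound;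
  exists n => /=.
Qed.

Section tonelli.
Context d d' (T : measurableType d) (U : measurableType d') (R : realType).
Variables (mu : {finite_measure set T -> \bar R})
  (sigma : {sigma_finite_measure set U -> \bar R}).

(** Tonelli's theorem on the [mu \x mu] side needs a sigma-finite structure on
    [mu \x mu]; the one built here comes from its total mass. *)
Lemma tonelli_sections (A : set ((T * T) * U)) : measurable A ->
  measurable_fun setT (fun u => (mu \x mu) (ysection A u)) /\
  \int[mu \x mu]_z sigma (xsection A z) =
  \int[sigma]_u (mu \x mu) (ysection A u).
Proof.
move=> mA.
have mu2_fin : fin_num_fun (mu \x mu).
  apply: lty_fin_num_fun.
  rewrite [ltLHS](_ : _ = mu setT * mu setT).
    by rewrite ltey_eq fin_numM// fin_num_measure.
  by rewrite -setXTT; exact: product_measure1E.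
pose mu2 : {finite_measure set (T * T)%type -> \bar R} :=
  HB.pack (mu \x mu) (Measure_isFinite.Build _ _ _ (mu \x mu) mu2_fin).
split; first exact: (measurable_fun_ysection mu2 mA).
have := indic_fubini_tonelli mu2 sigma mA.
by rewrite indic_fubini_tonelli_FE// indic_fubini_tonelli_GE.
Qed.

End tonelli.

(** * Schur's test for measures with a density *)

Lemma young_ge0 (R : realType) (x y : \bar R) : 0 <= x -> 0 <= y ->
  2%:E * (x * y) <= x * x + y * y.
Proof.
have yy : +oo * +oo = +oo :> \bar R by exact: mulyy.
case: x => [x| |]; case: y => [y| |] //; rewrite ?lee_fin => x0 y0.
- by have := sqr_ge0 (x - y)%R; nra.
- by rewrite yy addey ?leey.
- by rewrite yy addye ?leey.
- by rewrite yy addye ?leey.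
Qed.

Section schur.
Context d d' (T : measurableType d) (U : measurableType d') (R : realType).
Variables (mu : {sigma_finite_measure set T -> \bar R})
  (sigma : {sigma_finite_measure set U -> \bar R}).

(** If the image of [mu] under [q] has density [g], the measure of [E] under the
    product of that image by itself is the integral of [g u * g v] over [E],
    and [2 * (g u * g v) <= g u ^+ 2 + g v ^+ 2] reduces it to the two
    marginals of [E].  Applying Tonelli to [mu] and [sigma], one variable at a
    time, expresses the left-hand side through [g] twice without integrating
    against the image measure. *)
Lemma schur_density (q : T -> U) (g : U -> \bar R) (E : set (U * U))
    (c : \bar R) :
  measurable_fun setT q -> measurable_fun setT g -> (forall u, 0 <= g u) ->
  (forall B, measurable B -> mu (q @^-1` B) = \int[sigma]_(u in B) g u) ->
  measurable E ->
  (forall u, sigma (xsection E u) <= c) ->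
  (forall u, sigma (ysection E u) <= c) ->
  (mu \x mu) [set z | E (q z.1, q z.2)] <= c * \int[sigma]_u (g u * g u).
Proof.
move=> mq mg g0 dens mE Ex Ey.
have mg2 : measurable_fun setT (fun u => g u * g u).
  exact: emeasurable_funM.
have mpre B : measurable B -> measurable (q @^-1` B).
  by move=> mB; rewrite -[X in measurable X]setTI; exact: mq.
have g20 u : 0 <= g u * g u by exact: mule_ge0.
have m1E : measurable_fun setT (EFin \o (\1_E : U * U -> R)).
  by apply/measurable_EFinP.
have i0 (V : Type) (A : set V) v : 0 <= (\1_A v : R)%:E.
  by rewrite lee_fin.
have c0 : 0 <= c by apply: le_trans (Ex point); exact: measure_ge0.
have tonelli_mu : (mu \x mu) [set z | E (q z.1, q z.2)] =
    \int[sigma]_v \int[sigma]_u ((\1_E (u, v))%:E * (g u * g v)).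
  transitivity (\int[mu]_x \int[sigma]_v ((\1_E (q x, v))%:E * g v)).
    apply: eq_integral => x _ /=.
    rewrite [X in mu X](_ : _ = q @^-1` xsection E (q x)); last first.
      by apply/seteqP; split => y /=; rewrite /xsection/= !inE.
    rewrite dens; last exact: measurable_xsection.
    rewrite integral_mkcond; apply: eq_integral => v _.
    by rewrite patchE mem_xsection indicE; case: ifPn; rewrite ?mul1e ?mul0e.
  rewrite (@fubini_tonelli _ _ _ _ _ mu sigma
    (fun z => (\1_E (q z.1, z.2))%:E * g z.2)); last 2 first.
  - apply: emeasurable_funM; last exact: measurableT_comp.
    apply: (measurableT_comp m1E).
    by apply/measurable_fun_pair => //=; exact: measurableT_comp.
  - by move=> z; rewrite mule_ge0.
  apply: eq_integral => v _ /=.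
  have mv : measurable_fun setT (fun x : U => (\1_E (x, v) : R)%:E).
    by apply: (measurableT_comp m1E); exact: pair2_measurable.
  rewrite ge0_integralZr//; last exact: (measurableT_comp mv).
  under [RHS]eq_integral do rewrite muleA.
  rewrite ge0_integralZr//; last 2 first.
  - by apply: emeasurable_funM.
  - by move=> x _; rewrite mule_ge0.
  congr (_ * _).
  transitivity (mu (q @^-1` ysection E v)).
    rewrite -[X in _ = mu X]setIT -integral_indic//; last first.
      by apply: mpre; exact: measurable_ysection.
    apply: eq_integral => x _; rewrite !indicE -mem_ysection.
    suff -> : (x \in q @^-1` ysection E v) = (q x \in ysection E v) by [].
    by apply/idP/idP; rewrite !inE.
  rewrite dens; last exact: measurable_ysection.
  rewrite [LHS]integral_mkcond; apply: eq_integral => u _.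
  by rewrite patchE mem_ysection indicE; case: ifPn; rewrite ?mul1e ?mul0e.
(* Doubling both sides avoids halving extended reals. *)
rewrite {}tonelli_mu -(@lee_pmul2l _ 2%:E)//.
have mK : measurable_fun setT (fun z : U * U =>
    (\1_E z)%:E * (g z.1 * g z.2)).
  by apply: emeasurable_funM => //; apply: emeasurable_funM;
    exact: measurableT_comp.
have mH : measurable_fun setT (fun z : U * U =>
    (\1_E z)%:E * (g z.1 * g z.1)).
  by apply: emeasurable_funM => //; apply: emeasurable_funM;
    exact: measurableT_comp.
have mH' : measurable_fun setT (fun z : U * U =>
    (\1_E z)%:E * (g z.2 * g z.2)).
  by apply: emeasurable_funM => //; apply: emeasurable_funM;
    exact: measurableT_comp.
have mint (f : U * U -> \bar R) : measurable_fun setT f ->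
    (forall z : U * U, 0 <= f z) ->
    measurable_fun setT (fun v => \int[sigma]_u f (u, v)).
  by move=> mf f0; exact: (measurable_fun_fubini_tonelli_G f).
have K0 z : 0 <= (\1_E z)%:E * (g z.1 * g z.2).
  by rewrite mule_ge0// mule_ge0.
have H0 z : 0 <= (\1_E z)%:E * (g z.1 * g z.1) by rewrite mule_ge0.
have H'0 z : 0 <= (\1_E z)%:E * (g z.2 * g z.2) by rewrite mule_ge0.
have mcol (f : U * U -> \bar R) v : measurable_fun setT f ->
    measurable_fun setT (fun u : U => f (u, v) : \bar R).
  by move=> mf; exact: (measurableT_comp mf (pair2_measurable v)).
have mrow (f : U * U -> \bar R) u : measurable_fun setT f ->
    measurable_fun setT (fun v : U => f (u, v) : \bar R).
  by move=> mf; exact: (measurableT_comp mf (pair1_measurable u)).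
have int1 A : measurable A -> \int[sigma]_u (\1_A u)%:E = sigma A.
  by move=> mA; rewrite integral_indic// setIT.
have half1 : \int[sigma]_v \int[sigma]_u ((\1_E (u, v))%:E * (g u * g u)) <=
    c * \int[sigma]_u (g u * g u).
  rewrite -(fubini_tonelli _ mH H0)/=.
  rewrite -ge0_integralZl//; apply: ge0_integral_mono => u.
    by apply: integral_ge0 => v _; rewrite mule_ge0.
  rewrite ge0_integralZr//; last exact: (mrow (EFin \o \1_E)).
  apply: lee_wpmul2r => //; apply: le_trans (Ex u).
  rewrite -int1; last exact: measurable_xsection.
  by apply: ge0_integral_mono => // v; rewrite !indicE mem_xsection.
have half2 : \int[sigma]_v \int[sigma]_u ((\1_E (u, v))%:E * (g v * g v)) <=
    c * \int[sigma]_u (g u * g u).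
  rewrite -ge0_integralZl//; apply: ge0_integral_mono => v.
    by apply: integral_ge0 => u _; rewrite mule_ge0.
  rewrite ge0_integralZr//; last exact: (mcol (EFin \o \1_E)).
  apply: lee_wpmul2r => //; apply: le_trans (Ey v).
  rewrite -int1; last exact: measurable_ysection.
  by apply: ge0_integral_mono => // u; rewrite !indicE mem_ysection.
apply: (@le_trans _ _ (\int[sigma]_v \int[sigma]_u
  ((\1_E (u, v))%:E * (g u * g u) + (\1_E (u, v))%:E * (g v * g v)))).
  rewrite -ge0_integralZl//; last 2 first.
  - exact: (mint _ mK).
  - by move=> v _; apply: integral_ge0 => u _; exact: (K0 (u, v)).
  apply: ge0_integral_mono => v.
    by rewrite mule_ge0//; apply: integral_ge0 => u _; exact: (K0 (u, v)).
  rewrite -ge0_integralZl//; last exact: (mcol _ _ mK).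
  apply: ge0_integral_mono => u.
    by rewrite mule_ge0//; exact: (K0 (u, v)).
  rewrite -ge0_muleDr// muleCA lee_wpmul2l//.
  exact: young_ge0.
under eq_integral => v _.
  rewrite ge0_integralD//; last 2 first.
  - exact: (mcol _ _ mH).
  - exact: (mcol _ _ mH').
  over.
rewrite ge0_integralD//; last 4 first.
- by move=> v _; apply: integral_ge0 => u _; exact: (H0 (u, v)).
- exact: (mint _ mH).
- by move=> v _; apply: integral_ge0 => u _; exact: (H'0 (u, v)).
- exact: (mint _ mH').
rewrite -[X in X%:E * (c * _)]/(1 + 1)%R EFinD ge0_muleDl// !mul1e.
exact: leeD half1 half2.
Qed.
End schur.

(** * The angles under which a vector has a short projection *)

Lemma measurable_norm_le d (T : measurableType d) (R : realType)
    (f : T -> R) (delta : R) :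
  measurable_fun setT f -> measurable [set x | (`|f x| <= delta)%R].
Proof.
move=> mf; rewrite (_ : mkset _ = (fun x => `|f x|%R) @^-1` `]-oo, delta]).
  rewrite -[X in measurable X]setTI.
  by apply: (measurableT_comp (@normr_measurable R setT) mf).
by apply/seteqP; split => x /=; rewrite in_itv.
Qed.

Section geometry.
Context {R : realType}.
Implicit Types (z : R * R) (I A : set R) (s t r delta : R).

(** The mean value theorem, with [`|cos| <= 1]. *)
Lemma norm_sin_le s : (`|sin s| <= `|s|)%R.
Proof.
wlog s0 : s / (0 <= s)%R => [th|].
  have [/th//|/ltW s0] := leP 0%R s.
  by rewrite -normrN -sinN -[leRHS]normrN th// oppr_ge0.
have [c _] := @MVT_segment R sin cos 0%R s s0 (fun x _ => is_derive_sin x)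
  (continuous_subspaceT (@continuous_sin R)).
rewrite sin0 !subr0 => ->.
by rewrite normrM ler_piMl// ler_norml cos_geN1 cos_le1.
Qed.

Lemma lebesgue_measure_shift r A : measurable A ->
  lebesgue_measure ((fun t => t + r)%R @^-1` A) = lebesgue_measure A.
Proof.
move=> mA.
have mr : measurable_fun setT (fun t : R => t + r)%R by exact: measurable_funD.
pose m : {measure set (measurableTypeR R) -> \bar R} :=
  pushforward (@lebesgue_measure R)
    ((fun t => t + r)%R : measurableTypeR R -> measurableTypeR R).
apply/esym; apply: (@lebesgue_measure_unique R (m mr) _ _ mA) => _ [[a b] _ <-].
transitivity (lebesgue_measure `](a - r)%R, (b - r)%R]%classic); last first.
  congr (lebesgue_measure _).
  by apply/seteqP; split=> t /=; rewrite !in_itv/= ltrBlDr lerBrDr.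
rewrite !lebesgue_measure_itv/= !lte_fin ltrD2r; case: ifP => // _.
by rewrite -!EFinB; congr EFin; lra.
Qed.

(** The part of [perp I] obtained by shifting pieces of [I], which makes it
    measurable when [I] is: angles below [pi / 2] move up by [pi / 2], the
    others move down by as much.  For [I] inside [[0, pi[] it is all of
    [perp I]. *)
Definition perp_part I : set R :=
  (`[(pi / 2)%R, pi%R[ `&` (fun t => t - pi / 2)%R @^-1` I) `|`
  (`[0%R, (pi / 2)%R[ `&` (fun t => t + pi / 2)%R @^-1` I).

Lemma perp_part_sub I : perp_part I `<=` perp I.
Proof.
have p0 := @pi_gt0 R.
move=> t [[]|[]] /=; rewrite in_itv/= => /andP[t1 t2] It; split;
  try by apply/andP; split; lra.
- by exists (t - pi / 2)%R, 0%R; split=> //; rewrite mul0r addr0 subrK.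
- by exists (t + pi / 2)%R, (-1)%R; split=> //; rewrite mulN1r; lra.
Qed.

Lemma measurable_perp_part I : measurable I -> measurable (perp_part I).
Proof.
move=> mI; apply: measurableU; apply: measurableI => //.
- rewrite -[X in measurable X]setTI.
  by apply: (measurable_funB (@measurable_id _ _ _) (measurable_cst _)).
- rewrite -[X in measurable X]setTI.
  by apply: (measurable_funD (@measurable_id _ _ _) (measurable_cst _)).
Qed.

Definition strip delta z : set R :=
  [set t | `|z.1 * cos t + z.2 * sin t| <= delta]%R.

Lemma measurable_strip delta z : measurable (strip delta z).
Proof.
apply: measurable_norm_le; apply: measurable_funD; apply: measurable_funM => //;
  apply: continuous_measurable_fun;
  [exact: continuous_cos|exact: continuous_sin].
Qed.

(** The interval of centre [s] and radius [delta / `|r|] lies in [I] for small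
    [delta], and turning it by a right angle puts it in the strip because
    [`|r * sin (t - s)| <= `|r| * `|t - s|].  Turning modulo [pi] cuts the
    interval at [pi / 2], into pieces shifted in opposite directions: the
    shifts preserve length and the images stay disjoint. *)
Lemma strip_perp_part I s r : open I -> I `<=` `[0%R, pi] -> I s -> r != 0%R ->
  \forall delta \near 0%R^'+,
    (delta * 2 / `|r|)%:E <=
    lebesgue_measure (perp_part I `&` strip delta (polar s r)).
Proof.
move=> oI I_sub Is r0.
have rp : (0 < `|r|)%R by rewrite normr_gt0.
(* An open subset of [[0, pi]] avoids the end points, so that the shifted
   pieces stay inside [[0, pi[]. *)
have {}I_sub : I `<=` `]0%R, pi%R[%classic.
  by rewrite -(interior_itv_bnd 0%R pi true false) -open_subsetE.
have [e /= e0 eI] : exists2 e : R, (0 < e)%R & ball s e `<=` I.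
  by apply/nbhs_ballP; exact: open_nbhs_nbhs.
near=> delta.
have delta0 : (0 < delta)%R by near: delta; exact: nbhs_right_gt.
have delta_e : (delta / `|r| < e)%R.
  rewrite ltr_pdivrMr//; near: delta; apply: nbhs_right_lt; exact: mulr_gt0.
set a := (delta / `|r|)%R in delta_e *.
pose B : set R := `](s - a)%R, (s + a)%R[%classic.
have BI : B `<=` I.
  move=> t /=; rewrite /B/= in_itv/= => /andP[t1 t2]; apply: eI.
  by rewrite /ball/= ltr_norml; apply/andP; split; lra.
have mB : measurable B by exact: measurable_itv.
pose B1 := B `&` `]-oo, (pi / 2)%R[%classic.
pose B2 := B `&` `[(pi / 2)%R, +oo[%classic.
have mB1 : measurable B1 by exact: measurableI.
have mB2 : measurable B2 by exact: measurableI.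
pose C1 := (fun t : R => t + - (pi / 2))%R @^-1` B1.
pose C2 := (fun t : R => t + pi / 2)%R @^-1` B2.
have mC1 : measurable C1.
  rewrite -[X in measurable X]setTI.
  by apply: (measurable_funD (@measurable_id _ _ _) (measurable_cst _)).
have mC2 : measurable C2.
  rewrite -[X in measurable X]setTI.
  by apply: (measurable_funD (@measurable_id _ _ _) (measurable_cst _)).
have -> : (delta * 2 / `|r|)%:E = lebesgue_measure (C1 `|` C2).
  have dC : C1 `&` C2 = set0.
    apply/seteqP; split => // t -[].
    rewrite /C1 /C2 /B1 /B2 /= => -[/BI/I_sub/=]; rewrite !in_itv/= ?andbT.
    move=> /andP[h1 h2] h3 [/BI/I_sub/=]; rewrite !in_itv/= => /andP[h4 h5] h6.
    by exfalso; lra.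
  have dB : B1 `&` B2 = set0.
    apply/seteqP; split => // t -[]; rewrite /B1 /B2 /= !in_itv/= andbT.
    by move=> [_ h1] [_ h2]; exfalso; lra.
  transitivity (lebesgue_measure C1 + lebesgue_measure C2); last first.
    by apply/esym; exact: measureU.
  transitivity (lebesgue_measure B1 + lebesgue_measure B2); last first.
    by congr (_ + _); apply/esym; exact: lebesgue_measure_shift.
  transitivity (lebesgue_measure (B1 `|` B2)); last exact: measureU.
  have -> : B1 `|` B2 = B.
    rewrite /B1 /B2 -setIUr; apply/setIidPl => t _ /=; rewrite !in_itv/= andbT.
    by case: (ltP t (pi / 2)%R) => ?; [left|right].
  rewrite /B lebesgue_measure_itv/= lte_fin.
  have a0 : (0 < a)%R by rewrite divr_gt0.
  rewrite ifT; last by lra.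
  by rewrite -EFinB; congr EFin; rewrite /a; field; rewrite gt_eqF.
have near_s t : B t -> (`|r * sin (t - s)| <= delta)%R.
  rewrite /B/= in_itv/= => /andP[t1 t2]; rewrite normrM.
  rewrite mulrC -ler_pdivlMr// (le_trans (norm_sin_le _))// -/a.
  by rewrite ler_norml; apply/andP; split; lra.
have mS : measurable (strip delta (polar s r)) by exact: measurable_strip.
apply: le_measure; rewrite ?inE//; first exact: measurableU.
  apply: measurableI => //; apply: measurable_perp_part.
  exact: open_measurable.
move=> t [[Bt /=]|[Bt /=]]; rewrite in_itv/= ?andbT => ht; split.
- left; split; last exact: BI.
  have /I_sub/= := BI _ Bt; rewrite !in_itv/= => /andP[]; lra.
- rewrite /strip/= -normrN.
  rewrite [X in `|X|%R](_ : _ = r * sin (t - pi / 2 - s))%R;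
    first exact: near_s.
  by rewrite sinB sinBpihalf cosBpihalf; ring.
- right; split; last exact: BI.
  have /I_sub/= := BI _ Bt; rewrite !in_itv/= => /andP[]; lra.
- rewrite /strip/=.
  rewrite [X in `|X|%R](_ : _ = r * sin (t + pi / 2 - s))%R;
    first exact: near_s.
  by rewrite sinB sinDpihalf cosDpihalf; ring.
Unshelve. all: by end_near.
Qed.

Lemma cmod_polar s r : cmod (polar s r) = `|r|%R.
Proof.
rewrite /cmod /= -sqrtr_sqr; congr Num.sqrt.
by rewrite !exprMn -mulrDr cos2Dsin2 mulr1.
Qed.

End geometry.

(** * Pairs of points with close projections *)

Lemma poweR2 (R : realType) (x : \bar R) : 0 <= x -> x `^ 2 = x * x.
Proof.
case: x => [r| |]// r0.
  by rewrite poweR_EFin powR_mulrn// -EFinM expr2.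
by rewrite poweRyr// mulyy.
Qed.

Section density.
Context (R : realType).
Variable mu : {finite_measure set (R * R)%type -> \bar R}.

(** [polar t] carries length on [R] to length on the line, so a density [f] of
    the projected measure on the line becomes the density [f \o polar t] of the
    image of [mu] under the linear form [q], with the same L2 norm.  The set
    [`|u - v| <= delta] has sections of length [delta * 2], which is the
    constant in Schur's test. *)
Lemma proj_close_pairs t (delta : R) : (0 < delta)%R ->
  (mu \x mu) [set z | strip delta (z.1 - z.2)%R t] <=
  (delta * 2)%:E *
  density_L2norm (pushforward mu (line_proj t)) (line_length t) ^+ 2.
Proof.
move=> delta0; have d20 : (0 < delta * 2)%R by rewrite mulr_gt0.
rewrite /density_L2norm; case: pselect => [h|_]; last first.
  by rewrite expe2 mulyy gt0_muley ?lte_fin ?leey.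
case: (cid h) => f /= [mf f0 dens] {h}.
have mpolar : measurable_fun setT (polar t) := @measurable_polar R t.
pose g r := f (polar t r).
pose q (z : R * R) := (z.1 * cos t + z.2 * sin t)%R.
have mq : measurable_fun setT q.
  by apply: measurable_funD; apply: measurable_funM.
have mg : measurable_fun setT g by exact: measurableT_comp.
have qpolar r : q (polar t r) = r.
  by rewrite /q /= -!mulrA -mulrDr -!expr2 cos2Dsin2 mulr1.
have gdens B : measurable B ->
    mu (q @^-1` B) = \int[lebesgue_measure]_(u in B) g u.
  move=> mB.
  have mqB : measurable (q @^-1` B).
    by rewrite -[X in measurable X]setTI; exact: mq.
  rewrite -(_ : line_proj t @^-1` (q @^-1` B) = q @^-1` B); last first.
    by apply/seteqP; split=> z /=; rewrite /line_proj qpolar.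
  have := dens _ mqB; rewrite /pushforward => ->.
  rewrite ge0_integral_pushforward//; last by exact: measurable_funTS.
  congr (\int[_]_(u in _) _).
  by apply/seteqP; split=> r /=; rewrite qpolar.
have -> : [set z : (R * R) * (R * R) | strip delta (z.1 - z.2)%R t] =
    [set z | [set p : R * R | (`|p.1 - p.2| <= delta)%R] (q z.1, q z.2)].
  apply/seteqP; split=> z; rewrite /strip /q /=;
    congr (is_true (`|_| <= _)%R); ring.
rewrite [X in _ * X](_ : _ = \int[lebesgue_measure]_u (g u * g u)); last first.
  rewrite -poweR2 ?Lnorm_ge0// poweR_Lnorm//.
  under eq_integral => z _ do rewrite gee0_abs// poweR2//.
  rewrite ge0_integral_pushforward//; first exact: emeasurable_funM.
  by move=> z _; exact: mule_ge0.
have mE : measurable [set p : R * R | (`|p.1 - p.2| <= delta)%R].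
  by apply: measurable_norm_le; exact: measurable_funB.
have len u : lebesgue_measure `[(u - delta)%R, (u + delta)%R]%classic <=
    (delta * 2)%:E.
  rewrite lebesgue_measure_itv/= lte_fin; case: ifPn => _; last first.
    by rewrite lee_fin ltW.
  by rewrite -EFinB lee_fin; lra.
have xE u : xsection [set p : R * R | (`|p.1 - p.2| <= delta)%R] u =
    `[(u - delta)%R, (u + delta)%R]%classic.
  rewrite xsectionE; apply/seteqP; split => v /=; rewrite in_itv/= ler_norml
    => /andP[? ?]; apply/andP; split; lra.
have yE u : ysection [set p : R * R | (`|p.1 - p.2| <= delta)%R] u =
    `[(u - delta)%R, (u + delta)%R]%classic.
  rewrite ysectionE; apply/seteqP; split => v /=; rewrite in_itv/= ler_norml
    => /andP[? ?]; apply/andP; split; lra.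
apply: (@schur_density _ _ _ _ _ mu (@lebesgue_measure R) q g
  [set p : R * R | (`|p.1 - p.2| <= delta)%R] (delta * 2)%:E) => //.
- by move=> u; exact: f0.
- by move=> u; rewrite xE; exact: len.
- by move=> u; rewrite yE; exact: len.
Qed.

End density.

(** * The inequality *)

Theorem corollary3p3 (R : realType)
    (mu : {finite_measure set (R * R)%type -> \bar R}) (I : set R)
    (mu_compact : compact (msupport mu))
    (openI : open I) (I_sub : I `<=` `[0%R, pi]) :
  \int[mu \x mu]_(z in [set z | (cone I `\ 0%R) (z.1 - z.2)%R])
      ((cmod (z.1 - z.2)%R)^-1)%:E
  <= \int[lebesgue_measure]_(t in perp I)
      density_L2norm (pushforward mu (line_proj t)) (line_length t) ^+ 2.
Proof.
have mJ := measurable_perp_part (open_measurable openI).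
(* The triples [((x, y), t)] whose measure both sides are compared with. *)
pose A delta : set (((R * R) * (R * R)) * R) :=
  (setT `*` perp_part I) `&` [set p | strip delta (p.1.1 - p.1.2)%R p.2].
have mA delta : measurable (A delta).
  apply: measurableI; first exact: measurableX.
  apply: measurable_norm_le.
  have m11 : measurable_fun setT
      (fun p : ((R * R) * (R * R)) * R => p.1.1.1 - p.1.2.1)%R.
    apply: measurable_funB.
      exact: (measurableT_comp measurable_fst
        (measurableT_comp measurable_fst measurable_fst)).
    exact: (measurableT_comp measurable_fst
      (measurableT_comp measurable_snd measurable_fst)).
  have m12 : measurable_fun setT
      (fun p : ((R * R) * (R * R)) * R => p.1.1.2 - p.1.2.2)%R.
    apply: measurable_funB.
      exact: (measurableT_comp measurable_snd
        (measurableT_comp measurable_fst measurable_fst)).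
    exact: (measurableT_comp measurable_snd
      (measurableT_comp measurable_snd measurable_fst)).
  have mcos : measurable_fun setT
      (fun p : ((R * R) * (R * R)) * R => cos p.2).
    apply: measurableT_comp => //.
    by apply: continuous_measurable_fun; exact: continuous_cos.
  have msin : measurable_fun setT
      (fun p : ((R * R) * (R * R)) * R => sin p.2).
    apply: measurableT_comp => //.
    by apply: continuous_measurable_fun; exact: continuous_sin.
  by apply: measurable_funD; exact: measurable_funM.
have xA delta z : xsection (A delta) z =
    perp_part I `&` strip delta (z.1 - z.2)%R.
  by rewrite xsectionE; apply/seteqP; split => t /= [] // [_ ?].
pose delta n : R := (n.+1%:R^-1)%R.
have delta0 n : (0 < delta n)%R by rewrite invr_gt0.
pose c n : \bar R := ((delta n * 2)^-1)%:E.
have c0 n : 0 <= c n by rewrite lee_fin invr_ge0 mulr_ge0// ltW.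
pose G n z := c n * lebesgue_measure (xsection (A (delta n)) z).
have mX n :=
  @measurable_fun_xsection _ _ _ _ R lebesgue_measure _ (mA (delta n)).
have mG n : measurable_fun setT (G n).
  by apply: measurable_funeM; exact: mX.
have G0 n z : 0 <= G n z by rewrite mule_ge0.
rewrite integral_mkcond; apply: (@le_trans _ _
    (\int[mu \x mu]_z limn_einf (G ^~ z))).
  apply: ge0_integral_mono => z.
    by apply: erestrict_ge0 => w _; rewrite lee_fin invr_ge0 sqrtr_ge0.
  apply: limn_einf_ge_near; rewrite patchE; case: ifPn => [|_]; last first.
    by apply: nearW => n; exact: G0.
  move/set_mem => /= [[r [s [Is zE]]] z0].
  have r0 : r != 0%R.
    by apply: contra_not_neq z0 => r0; rewrite zE r0 /polar !mul0r.
  have rp : (0 < `|r|)%R by rewrite normr_gt0.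
  (* The angular estimate makes the normalised section at least
     [1 / `|r|] as soon as [delta n] is small. *)
  have [e /= e0 He] := strip_perp_part openI I_sub Is r0.
  near=> n.
  rewrite /G /c xA zE cmod_polar lee_pdivlMl ?mulr_gt0// -EFinM.
  apply: He => //=; rewrite sub0r normrN gtr0_norm//.
  by near: n; exact: (near_infty_natSinv_lt (PosNum e0)).
apply: le_trans (fatou _ _ _ _) _ => //.
apply: limn_einf_le => n.
rewrite ge0_integralZl//; last exact: mX.
(* From now on [delta n] is fixed and the angle is integrated last. *)
have [mY tonelli] := tonelli_sections mu lebesgue_measure (mA (delta n)).
rewrite {}tonelli -ge0_integralZl//.
rewrite [leRHS]integral_mkcond; apply: ge0_integral_mono => t.
  by rewrite mule_ge0.
rewrite patchE.
have [Jt|nJt] := pselect (perp_part I t); last first.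
  rewrite (_ : ysection _ _ = set0) ?measure0 ?mule0.
    by case: ifPn => // _; exact: sqre_ge0.
  by rewrite ysectionE; apply/seteqP; split => z //= [[]].
rewrite mem_set; last exact: perp_part_sub.
rewrite (_ : ysection _ _ =
  [set z | strip (delta n) (z.1 - z.2)%R t]); last first.
  by rewrite ysectionE; apply/seteqP; split => z //= [].
rewrite lee_pdivrMl ?mulr_gt0//.
exact: proj_close_pairs.
Unshelve. all: by end_near.
Qed.
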